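(* For every $k\ge 3$ and $n\ge 2$ there exists a homomorphic embedding (injective group homomorphism) $\iota: nG_{2,1}^{\rm unif}\hookrightarrow nG_{k,1}$.
   Context: For an integer $k\ge 1$ let $A_k=\{a_0,\dots,a_{k-1}\}$ be an alphabet with $k$ letters. For an alphabet $A$, $A^*$ is the set of finite strings over $A$ (with empty string $\varepsilon$), $A^m$ the set of strings of length $m$, and $A^\omega$ the set of infinite strings indexed by $\omega$. $nA^*$ is the $n$-fold direct product of the free monoid $A^*$ with coordinatewise concatenation, and $nA^\omega$ is the $n$-fold cartesian product of $A^\omega$. For $u,v\in nA^*$, $u\le_{\rm init} v$ iff $v=ux$ for some $x\in nA^*$; the join $u\vee v$ is the $\le_{\rm init}$-least common upper bound of $u$ and $v$ (it exists iff for every $i$, one of $u_i,v_i$ is a prefix of the other). A joinless code is a set $S\subseteq nA^*$ in which no two distinct elements have a join; it is maximal if it is $\subseteq$-maximal among joinless codes of $nA^*$. ''Function'' means partial function. A right-ideal morphism of $nA^*$ is a function $f:nA^*\to nA^*$ with $f(xw)=f(x)w$ for all $x\in{\rm Dom}(f)$, $w\in nA^*$. $n\mathcal{RI}^{\sf fin}$ is the monoid (under composition) of injective right-ideal morphisms $f$ such that ${\rm Dom}(f)={\rm domC}(f)\cdot nA^*$ and ${\rm Im}(f)={\rm imC}(f)\cdot nA^*$ for finite maximal joinless codes ${\rm domC}(f)$, ${\rm imC}(f)$. Such $f$ is determined by the bijection ${\rm domC}(f)\to{\rm imC}(f)$ (its table), and it induces a permutation $f^{(\omega)}$ of $nA^\omega$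 by $f^{(\omega)}(pu)=f(p)\,u$ for $p\in{\rm domC}(f)$, $u\in nA^\omega$. For $n\ge1$, $k\ge2$, the Brin-Higman-Thompson group $nG_{k,1}$ is the group of all permutations $f^{(\omega)}$ of $nA_k^{\,\omega}$ with $f\in n\mathcal{RI}^{\sf fin}$ over the alphabet $A_k$; one says $f$ represents $f^{(\omega)}$. A uniform product code in $nA^*$ is a set of the form $A^{m_1}\times\dots\times A^{m_n}$ with $m_1,\dots,m_n\in\mathbb{N}$ (including $0$). A uniform morphism is an $f\in n\mathcal{RI}^{\sf fin}$ such that ${\rm domC}(f)$ and ${\rm imC}(f)$ are both uniform product codes. $nG_{k,1}^{\rm unif}$ is the subgroup of $nG_{k,1}$ consisting of the elements that can be represented by uniform morphisms. *)

(* Defs.v *)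
From HB Require Import structures.
From mathcomp Require Import all_boot.
From mathcomp Require Import boolp classical_sets cardinality.

Set Implicit Arguments.
Unset Strict Implicit.
Unset Printing Implicit Defensive.

Local Open Scope classical_set_scope.

Record permutation (T : Type) := Permutation {
  perm_fun :> T -> T;
  perm_inv : T -> T;
  perm_funK : cancel perm_fun perm_inv;
  perm_invK : cancel perm_inv perm_fun
}.

HB.instance Definition _ T := gen_eqMixin (permutation T).
HB.instance Definition _ T := gen_choiceMixin (permutation T).

Lemma permutation_ext T (f g : permutation T) : f =1 g -> f = g.
Proof.
case: f g => [f f' fK f'K] [g g' gK g'K] /= /funext efg; subst g.
have efg' : f' = g' by apply: funext => x; rewrite -{1}(g'K x) fK.
subst g'; congr Permutation; exact: Prop_irrelevance.
Qed.

Section PermutationGroup.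
Variable T : Type.
Implicit Types f g : permutation T.

Definition permutation_one : permutation T :=
  @Permutation T id id (fun=> erefl) (fun=> erefl).

Definition permutation_inv f : permutation T :=
  Permutation (perm_invK f) (perm_funK f).

(* Permutations act on the left: (f * g) x = f (g x). *)
Definition permutation_mul f g : permutation T :=
  Permutation (can_comp (perm_funK f) (perm_funK g))
              (can_comp (perm_invK g) (perm_invK f)).

Lemma permutation_mulA : associative permutation_mul.
Proof. by move=> f g h; apply: permutation_ext. Qed.

Lemma permutation_mul1g : left_id permutation_one permutation_mul.
Proof. by move=> f; apply: permutation_ext. Qed.

Lemma permutation_mulg1 : right_id permutation_one permutation_mul.
Proof. by move=> f; apply: permutation_ext. Qed.

Lemma permutation_mulVg :
  left_inverse permutation_one permutation_inv permutation_mul.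
Proof. by move=> f; apply: permutation_ext => x /=; rewrite perm_funK. Qed.

Lemma permutation_mulgV :
  right_inverse permutation_one permutation_inv permutation_mul.
Proof. by move=> f; apply: permutation_ext => x /=; rewrite perm_invK. Qed.

HB.instance Definition _ := isGroup.Build (permutation T)
  permutation_mulA permutation_mul1g permutation_mulg1
  permutation_mulVg permutation_mulgV.

End PermutationGroup.

Section Words.
Variables n k : nat.

(* [word] is nA_k^* and [omega] is nA_k^omega, with A_k = 'I_k. *)
Definition word := {ffun 'I_n -> seq 'I_k}.
Definition omega := 'I_n -> nat -> 'I_k.

Definition wcat (u v : word) : word := [ffun i => u i ++ v i].

Definition wnil : word := [ffun=> [::]].

Definition ocat (u : word) (x : omega) : omega := fun i j =>
  if j < size (u i) then nth (x i 0) (u i) j else x i (j - size (u i)).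

Definition le_init (u v : word) := exists x, v = wcat u x.

Definition is_join (u v w : word) :=
  [/\ le_init u w, le_init v w &
      forall z, le_init u z -> le_init v z -> le_init w z].

Definition joinless (S : set word) :=
  forall u v, S u -> S v -> u <> v -> ~ exists w, is_join u v w.

Definition maximal_joinless (S : set word) :=
  joinless S /\ forall S', joinless S' -> S `<=` S' -> S' = S.

Definition right_ideal (S : set word) : set word :=
  [set y | exists2 p, S p & exists w, y = wcat p w].

(* A partial function nA^* -> nA^*, undefined where its value is [None]. *)
Definition pfun := word -> option word.

Definition Dom (f : pfun) : set word := [set x | exists y, f x = Some y].
Definition Im (f : pfun) : set word := [set y | exists x, f x = Some y].

Definition pinjective (f : pfun) :=
  forall x x' y, f x = Some y -> f x' = Some y -> x = x'.

Definition right_ideal_morphism (f : pfun) :=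
  forall x y w, f x = Some y -> f (wcat x w) = Some (wcat y w).

(* [is_domC f P] reads domC(f) = P, and [is_imC f Q] reads imC(f) = Q; these
   codes are unique when they exist ([code_uniq] below). *)
Definition is_domC (f : pfun) (P : set word) :=
  joinless P /\ Dom f = right_ideal P.
Definition is_imC (f : pfun) (Q : set word) :=
  joinless Q /\ Im f = right_ideal Q.

Definition nRIfin (f : pfun) :=
  [/\ pinjective f, right_ideal_morphism f,
      exists P, [/\ is_domC f P, finite_set P & maximal_joinless P] &
      exists Q, [/\ is_imC f Q, finite_set Q & maximal_joinless Q]].

Definition represents (f : pfun) (phi : permutation omega) :=
  forall P p q (u : omega), is_domC f P -> P p -> f p = Some q ->
    phi (ocat p u) = ocat q u.

(* The code A^{m_0} x ... x A^{m_{n-1}}. *)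
Definition uniform_product_code (m : 'I_n -> nat) : set word :=
  [set x | forall i, size (x i) = m i].

Definition uniform_morphism (f : pfun) :=
  [/\ nRIfin f, exists m, is_domC f (uniform_product_code m) &
      exists m, is_imC f (uniform_product_code m)].

Lemma wcatA u v w : wcat u (wcat v w) = wcat (wcat u v) w.
Proof. by apply/ffunP => i; rewrite !ffunE catA. Qed.

Lemma wcats0 u : wcat u wnil = u.
Proof. by apply/ffunP => i; rewrite !ffunE cats0. Qed.

Lemma wcat0s u : wcat wnil u = u.
Proof. by apply/ffunP => i; rewrite !ffunE. Qed.

Lemma wcatI u v w : wcat u v = wcat u w -> v = w.
Proof.
move=> /ffunP e; apply/ffunP => i; move: (e i); rewrite !ffunE => /eqP.
by rewrite eqseq_cat // eqxx /= => /eqP.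
Qed.

Lemma wcat_nilr u v : u = wcat u v -> v = wnil.
Proof. by move=> e; apply: (@wcatI u); rewrite wcats0. Qed.

Lemma wcat_eq_nil u v : wcat u v = wnil -> u = wnil /\ v = wnil.
Proof.
move=> /ffunP e; split; apply/ffunP => i; move: (e i); rewrite !ffunE;
  by case: (u i) (v i) => [|? ?] [|? ?].
Qed.

Lemma ocat_cat u v (x : omega) : ocat (wcat u v) x = ocat u (ocat v x).
Proof.
apply: funext => i; apply: funext => j; rewrite /ocat !ffunE size_cat nth_cat.
have [lt_ju|le_uj] := ltnP j (size (u i)).
  by rewrite ltn_addr //; apply: set_nth_default.
by rewrite -{1}(subnKC le_uj) ltn_add2l subnDA.
Qed.

Definition compat u v := exists a b, wcat u a = wcat v b.

Definition wjoin (u v : word) : word :=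
  [ffun i => if size (u i) <= size (v i) then v i else u i].

Lemma prefix_cat_drop (T : Type) (s t a b : seq T) :
  s ++ a = t ++ b -> size s <= size t -> t = s ++ drop (size s) t.
Proof.
move=> e le_st; rewrite -{1}(cat_take_drop (size s) t); congr (_ ++ _).
by rewrite -(takel_cat b le_st) -e take_size_cat.
Qed.

Lemma compat_join u v : compat u v -> is_join u v (wjoin u v).
Proof.
move=> [a [b /ffunP e]]; split.
- exists [ffun i => drop (size (u i)) (v i)]; apply/ffunP => i.
  move: (e i); rewrite !ffunE; case: leqP => [le_uv|lt_vu] ei.
    exact: (prefix_cat_drop ei).
  by rewrite drop_oversize ?cats0 // ltnW.
- exists [ffun i => drop (size (v i)) (u i)]; apply/ffunP => i.
  move: (e i); rewrite !ffunE; case: leqP => [le_uv|lt_vu] ei.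
    by rewrite drop_oversize ?cats0.
  by apply: (prefix_cat_drop (esym ei)); rewrite ltnW.
- move=> z [c ec] [d ed].
  exists [ffun i => if size (u i) <= size (v i) then d i else c i].
  apply/ffunP => i; rewrite !ffunE; case: leqP => _; first by rewrite ed ffunE.
  by rewrite ec ffunE.
Qed.

Lemma joinlessP S :
  joinless S <-> forall u v, S u -> S v -> compat u v -> u = v.
Proof.
split=> [jS u v Su Sv /compat_join uv|cS u v Su Sv nuv [w [[a ->] [b e] _]]].
  by apply: contrapT => /(jS _ _ Su Sv); apply; exists (wjoin u v).
by apply: nuv; apply: cS => //; exists a, b.
Qed.

Lemma maximal_joinlessP S : maximal_joinless S <->
  joinless S /\ forall x, exists2 s, S s & compat s x.
Proof.
split=> [[jS mS]|[jS cS]]; split=> //.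
  move=> x; apply: contrapT => nx.
  have nSx s : S s -> ~ compat s x by move=> Ss sx; apply: nx; exists s.
  have jS' : joinless (S `|` [set x]).
    apply/joinlessP => u v [Su|->] [Sv|->] // uv.
    - by move/joinlessP: jS; apply.
    - by case: (nSx _ Su).
    - by case: (nSx _ Sv); case: uv => a [b e]; exists b, a.
  have : S x by rewrite -(mS _ jS') => [|y Sy]; [right | left].
  by move=> Sx; apply: (nSx _ Sx); exists wnil, wnil.
move=> S' /joinlessP jS' sSS'; rewrite eqEsubset; split=> // x S'x.
by have [s Ss sx] := cS x; rewrite -(jS' s x) //; apply: sSS'.
Qed.

Lemma code_uniq P P' : joinless P -> joinless P' ->
  right_ideal P = right_ideal P' -> P = P'.
Proof.
suff sub A B : joinless A -> right_ideal A = right_ideal B -> A `<=` B.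
  by move=> jP jP' e; rewrite eqEsubset; split; apply: sub.
move=> /joinlessP jA e x Ax.
have [b Bb [w xE]] : right_ideal B x.
  by rewrite -e; exists x => //; exists wnil; rewrite wcats0.
have [a Aa [v bE]] : right_ideal A b.
  by rewrite e; exists b => //; exists wnil; rewrite wcats0.
have xa : x = a.
  by apply: jA => //; exists wnil, (wcat v w); rewrite wcats0 xE bE wcatA.
move: (xE); rewrite bE -xa -wcatA => /wcat_nilr/wcat_eq_nil[_ w0].
by rewrite xE w0 wcats0.
Qed.

Lemma representsW f phi x y u : nRIfin f -> represents f phi ->
  f x = Some y -> phi (ocat x u) = ocat y u.
Proof.
move=> [_ rf [P [[jP dP] _ _]] _] rep fx.
have [p Pp [w xE]] : right_ideal P x by rewrite -dP; exists y.
have [q fp] : Dom f p.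
  by rewrite dP; exists p => //; exists wnil; rewrite wcats0.
move: fx; rewrite xE (rf _ _ w fp) => -[<-]; rewrite !ocat_cat.
exact: (rep P).
Qed.

Lemma mem_right_ideal (P : set word) p : P p -> right_ideal P p.
Proof. by move=> Pp; exists p => //; exists wnil; rewrite wcats0. Qed.

Lemma domC_imC f P Q p q : pinjective f -> right_ideal_morphism f ->
  is_domC f P -> is_imC f Q -> P p -> f p = Some q -> Q q.
Proof.
move=> fI rf [/joinlessP jP dP] [/joinlessP jQ iQ] Pp fp.
have [q0 Qq0 [v qE]] : right_ideal Q q by rewrite -iQ; exists p.
have [y fy] : Im f q0 by rewrite iQ; apply: mem_right_ideal.
have pE : p = wcat y v by apply: (fI _ _ q) => //; rewrite (rf _ _ v fy) qE.
have [p' Pp' [w yE]] : right_ideal P y by rewrite -dP; exists q0.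
have pp' : p = p'.
  by apply: jP => //; exists wnil, (wcat w v); rewrite wcats0 wcatA -yE.
move: (pE); rewrite yE -pp' -wcatA => /wcat_nilr/wcat_eq_nil[_ v0].
by rewrite qE v0 wcats0.
Qed.

Lemma right_ideal_nil : right_ideal [set wnil] = setT.
Proof.
by rewrite eqEsubset; split=> // x _; exists wnil => //; exists x; rewrite wcat0s.
Qed.

Lemma maximal_nil : maximal_joinless [set wnil].
Proof.
apply/maximal_joinlessP; split; first by apply/joinlessP => u v -> ->.
by move=> x; exists wnil => //; exists x, wnil; rewrite wcat0s wcats0.
Qed.

Lemma upc0 : uniform_product_code (fun=> 0) = [set wnil].
Proof.
rewrite eqEsubset; split=> [x x0|x ->].
  by apply/ffunP => i; rewrite ffunE; apply: size0nil.
by move=> i; rewrite ffunE.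
Qed.

Lemma is_domC_id : is_domC Some [set wnil].
Proof.
split; first by case: maximal_nil.
by rewrite right_ideal_nil eqEsubset; split=> // x _; exists x.
Qed.

Lemma is_imC_id : is_imC Some [set wnil].
Proof.
split; first by case: maximal_nil.
by rewrite right_ideal_nil eqEsubset; split=> // x _; exists x.
Qed.

Lemma nRIfin_id : nRIfin Some.
Proof.
split.
- by move=> x x' y [->] [->].
- by move=> x y w [->].
- exists [set wnil]; split; [exact: is_domC_id | exact: finite_set1 |].
  exact: maximal_nil.
- exists [set wnil]; split; [exact: is_imC_id | exact: finite_set1 |].
  exact: maximal_nil.
Qed.

Lemma uniform_id : uniform_morphism Some.
Proof.
split; first exact: nRIfin_id.
- by exists (fun=> 0); rewrite upc0; apply: is_domC_id.
- by exists (fun=> 0); rewrite upc0; apply: is_imC_id.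
Qed.

Lemma represents_id : represents Some 1%g.
Proof. by move=> P p q u _ _ [->]. Qed.

Definition pinv (f : pfun) : pfun := fun y =>
  if pselect (exists x, f x = Some y) is left e then Some (projT1 (cid e))
  else None.

Lemma pinvP f x y : pinjective f -> pinv f y = Some x <-> f x = Some y.
Proof.
move=> fI; rewrite /pinv; case: pselect => [e|ne]; last first.
  by split=> // fx; case: ne; exists x.
case: cid => x' /= fx'; split=> [[<-] //|fx]; congr Some; exact: fI fx.
Qed.

Lemma Dom_pinv f : pinjective f -> Dom (pinv f) = Im f.
Proof.
by move=> fI; rewrite eqEsubset; split=> y [x /(pinvP _ _ fI) e]; exists x.
Qed.

Lemma Im_pinv f : pinjective f -> Im (pinv f) = Dom f.
Proof.
by move=> fI; rewrite eqEsubset; split=> y [x /(pinvP _ _ fI) e]; exists x.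
Qed.

Lemma nRIfin_inv f : nRIfin f -> nRIfin (pinv f).
Proof.
move=> [fI rf dP iQ]; split.
- move=> y y' x /(pinvP _ _ fI) fx /(pinvP _ _ fI).
  by rewrite fx => -[].
- by move=> y x w /(pinvP _ _ fI) fx; apply/(pinvP _ _ fI)/rf.
- by rewrite /is_domC Dom_pinv.
- by rewrite /is_imC Im_pinv.
Qed.

Lemma uniform_inv f : uniform_morphism f -> uniform_morphism (pinv f).
Proof.
move=> [rf]; case: (rf) => fI _ _ _ dm im; split; first exact: nRIfin_inv.
- by rewrite /is_domC Dom_pinv.
- by rewrite /is_imC Im_pinv.
Qed.

Lemma represents_inv f phi : nRIfin f -> represents f phi ->
  represents (pinv f) phi^-1%g.
Proof.
move=> rf rep P q p u _ _; case: (rf) => fI _ _ _ /(pinvP _ _ fI) fp.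
by rewrite -(representsW u rf rep fp) [LHS]perm_funK.
Qed.

Definition pcomp (g f : pfun) : pfun := fun x => obind g (f x).

Lemma pcompP g f x z :
  pcomp g f x = Some z <-> exists2 y, f x = Some y & g y = Some z.
Proof.
rewrite /pcomp; case: (f x) => [y|] /=; last by split=> // -[].
by split=> [gy|[_ [<-]]] //; exists y.
Qed.

Definition pim (f : pfun) (T : set word) : set word :=
  [set x | exists2 y, f x = Some y & T y].

Lemma pim_codes f P T : pinjective f -> right_ideal_morphism f ->
  is_domC f P -> maximal_joinless P ->
  finite_set T -> maximal_joinless T -> right_ideal T `<=` Im f ->
  [/\ finite_set (pim f T), maximal_joinless (pim f T) &
      right_ideal (pim f T) = pim f (right_ideal T)].
Proof.
move=> fI rf [_ dP] /maximal_joinlessP[_ cP] fT.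
move=> /maximal_joinlessP[/joinlessP jT cT] sT.
have rE : right_ideal (pim f T) = pim f (right_ideal T).
  rewrite eqEsubset; split=> [_ [p [q fp Tq] [w ->]]|x [y fx [t Tt [w yE]]]].
    by exists (wcat q w); [apply: rf | exists q => //; exists w].
  have [p fp] := sT _ (mem_right_ideal Tt).
  exists p; first by exists t.
  by exists w; apply: (fI _ _ y) => //; rewrite (rf _ _ w fp) yE.
split=> //.
- have -> : pim f T = [set x | exists2 t, T t & pinv f t = Some x].
    rewrite eqEsubset; split=> x [t].
      by move=> fx Tt; exists t => //; apply/(pinvP _ _ fI).
    by move=> Tt /(pinvP _ _ fI) fx; exists t.
  pose h t := odflt wnil (pinv f t).
  apply: (sub_finite_set (B := h @` T)); last exact: finite_image.
  by move=> x [t Tt e]; exists t => //; rewrite /h e.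
- apply/maximal_joinlessP; split.
    apply/joinlessP => x x' [t fx Tt] [t' fx' Tt'] [a [b e]].
    apply: (fI _ _ t) => //; rewrite fx'; congr Some; apply/esym/jT => //.
    exists a, b; apply: Some_inj.
    by rewrite -(rf _ _ a fx) -(rf _ _ b fx') e.
  move=> x; have [p Pp [a [b e]]] := cP x.
  have [y fy] : Dom f (wcat x b) by rewrite dP -e; exists p => //; exists a.
  have [t Tt [c [d etd]]] := cT y.
  have [z Tz [w zE]] : right_ideal (pim f T) (wcat (wcat x b) d).
    rewrite rE; exists (wcat y d); first exact: rf.
    by rewrite -etd; exists t => //; exists c.
  by exists z => //; exists w, (wcat b d); rewrite wcatA -zE.
Qed.

Definition joins (Q R : set word) : set word :=
  [set t | exists q r, [/\ Q q, R r, compat q r & t = wjoin q r]].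

Lemma joins_codes Q R :
  finite_set Q -> finite_set R -> maximal_joinless Q -> maximal_joinless R ->
  [/\ finite_set (joins Q R), maximal_joinless (joins Q R) &
      right_ideal (joins Q R) = right_ideal Q `&` right_ideal R].
Proof.
move=> fQ fR /maximal_joinlessP[/joinlessP jQ cQ].
move=> /maximal_joinlessP[/joinlessP jR cR].
have rE : right_ideal (joins Q R) = right_ideal Q `&` right_ideal R.
  rewrite eqEsubset; split=> [_ [_ [q [r [Qq Rr qr ->]]] [w ->]]|].
    have [[a ea] [b eb] _] := compat_join qr; split.
      by exists q => //; exists (wcat a w); rewrite wcatA -ea.
    by exists r => //; exists (wcat b w); rewrite wcatA -eb.
  move=> x [[q Qq [a ea]] [r Rr [b eb]]].
  have qr : compat q r by exists a, b; rewrite -ea.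
  have [_ _ lub] := compat_join qr.
  exists (wjoin q r); first by exists q, r.
  by apply: lub; [exists a | exists b].
split=> //.
- apply: (sub_finite_set (B := [set wjoin t.1 t.2 | t in Q `*` R])).
    by move=> t [q [r [Qq Rr _ ->]]]; exists (q, r).
  by apply: finite_image; apply: finite_setX.
- apply/maximal_joinlessP; split.
    apply/joinlessP => _ _ [q [r [Qq Rr qr ->]]] [q' [r' [Qq' Rr' qr' ->]]].
    have [[a ea] [b eb] _] := compat_join qr.
    have [[a' ea'] [b' eb'] _] := compat_join qr'.
    move=> [c [d ecd]].
    have -> : q = q'.
      apply: jQ => //; exists (wcat a c), (wcat a' d).
      by rewrite !wcatA -ea -ea'.
    suff -> : r = r' by [].
    apply: jR => //; exists (wcat b c), (wcat b' d).
    by rewrite !wcatA -eb -eb'.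
  move=> x; have [q Qq [a [b e]]] := cQ x.
  have [r Rr [c [d e']]] := cR (wcat x b).
  have [t Tt [w tE]] : right_ideal (joins Q R) (wcat (wcat x b) d).
    rewrite rE; split; last by rewrite -e'; exists r => //; exists c.
    by rewrite -e; exists q => //; exists (wcat a d); rewrite wcatA.
  by exists t => //; exists w, (wcat b d); rewrite wcatA.
Qed.

Lemma pcomp_codes f g Q R : nRIfin f -> nRIfin g ->
  is_imC f Q -> finite_set Q -> maximal_joinless Q ->
  is_domC g R -> finite_set R -> maximal_joinless R ->
  [/\ is_domC (pcomp g f) (pim f (joins Q R)),
      is_imC (pcomp g f) (pim (pinv g) (joins Q R)) & nRIfin (pcomp g f)].
Proof.
move=> rf rg [_ iQ] fQ mQ [_ dR] fR mR.
have [fT mT rT] := joins_codes fQ fR mQ mR.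
have [fI fM [P [dP _ mP]] _] := rf.
have [hI hM [S [dS _ mS]] _] := nRIfin_inv rg.
have [gI gM _ _] := rg.
have [|fP' mP' rP'] := pim_codes fI fM dP mP fT mT.
  by rewrite rT iQ; apply: subIsetl.
have [|fS' mS' rS'] := pim_codes hI hM dS mS fT mT.
  by rewrite rT Im_pinv // dR; apply: subIsetr.
have dh : is_domC (pcomp g f) (pim f (joins Q R)).
  split; first by case: mP'.
  rewrite rP' rT -iQ -dR eqEsubset; split=> x.
    by move=> [z /pcompP[y fx gy]]; exists y => //; split; [exists x|exists z].
  by move=> [y fx [_ [z gy]]]; exists z; apply/pcompP; exists y.
have ih : is_imC (pcomp g f) (pim (pinv g) (joins Q R)).
  split; first by case: mS'.
  rewrite rS' rT -iQ -dR eqEsubset; split=> z.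
    move=> [x /pcompP[y fx gy]]; exists y; first by apply/(pinvP _ _ gI).
    by split; [exists x | exists z].
  by move=> [y /(pinvP _ _ gI) gy [[x fx] _]]; exists x; apply/pcompP; exists y.
split=> //; split.
- move=> x x' z /pcompP[y fx gy] /pcompP[y' fx' gy'].
  by apply: fI fx _; rewrite (gI _ _ _ gy gy').
- move=> x z w /pcompP[y fx gy]; apply/pcompP; exists (wcat y w).
    exact: fM.
  exact: gM.
- by exists (pim f (joins Q R)).
- by exists (pim (pinv g) (joins Q R)).
Qed.

Lemma nRIfin_comp f g : nRIfin f -> nRIfin g -> nRIfin (pcomp g f).
Proof.
move=> rf rg; have [_ _ _ [Q [iQ fQ mQ]]] := rf.
have [_ _ [R [dR fR mR]] _] := rg.
by have [] := pcomp_codes rf rg iQ fQ mQ dR fR mR.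
Qed.

Lemma represents_comp f g phi psi : nRIfin f -> nRIfin g ->
  represents f phi -> represents g psi ->
  represents (pcomp g f) (psi * phi)%g.
Proof.
move=> rf rg rep reg P x z u _ _ /pcompP[y fx gy].
by rewrite -(representsW u rg reg gy) -(representsW u rf rep fx).
Qed.

Lemma upc_split m (x : word) : (forall i, m i <= size (x i)) ->
  exists p v, [/\ uniform_product_code m p, x = wcat p v &
    forall i, size (v i) = size (x i) - m i].
Proof.
move=> le_mx; exists [ffun i => take (m i) (x i)], [ffun i => drop (m i) (x i)].
split=> [i||i]; first by rewrite ffunE size_takel.
  by apply/ffunP => i; rewrite !ffunE cat_take_drop.
by rewrite ffunE size_drop.
Qed.

Lemma joins_upc m m' : joins (uniform_product_code m) (uniform_product_code m') =
  uniform_product_code (fun i => maxn (m i) (m' i)).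
Proof.
rewrite eqEsubset; split=> [_ [q [r [qm rm' _ ->]]] i|x xm].
  by rewrite ffunE qm rm' -[X in if X then _ else _]/(m i <= m' i) /maxn;
     case: (ltngtP (m i) (m' i)) => // e; rewrite ?qm ?rm' ?e.
have [|q [a [qm xE sa]]] := @upc_split m x.
  by move=> i; rewrite xm leq_maxl.
have [|r [b [rm' xE' sb]]] := @upc_split m' x.
  by move=> i; rewrite xm leq_maxr.
have qr : compat q r by exists a, b; rewrite -xE.
exists q, r; split=> //; apply/ffunP => i; rewrite ffunE qm rm'.
have [le_mm'|/ltnW le_m'm] := leqP.
  rewrite xE' ffunE; suff -> : b i = [::] by rewrite cats0.
  by apply: size0nil; rewrite sb xm (maxn_idPr le_mm') subnn.
rewrite xE ffunE; suff -> : a i = [::] by rewrite cats0.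
by apply: size0nil; rewrite sa xm (maxn_idPl le_m'm) subnn.
Qed.

Lemma pim_upc f m m' M : pinjective f -> right_ideal_morphism f ->
  is_domC f (uniform_product_code m) -> is_imC f (uniform_product_code m') ->
  (forall i, m' i <= M i) ->
  pim f (uniform_product_code M) =
  uniform_product_code (fun i => m i + (M i - m' i)).
Proof.
move=> fI fM df imf leM.
have key x p v : uniform_product_code m p -> x = wcat p v ->
    exists2 q, uniform_product_code m' q & f x = Some (wcat q v).
  move=> pm ->; have [q fp] : Dom f p.
    by case: df => _ ->; apply: mem_right_ideal.
  by exists q; [exact: (domC_imC fI fM df imf pm fp) | exact: fM].
rewrite eqEsubset; split=> x.
  move=> [y fx yM] i.
  have [p pm [v xE]] : right_ideal (uniform_product_code m) x.
    by case: df => _ <-; exists y.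
  have [q qm' ] := key _ _ _ pm xE; rewrite fx => -[yE].
  move: (yM i); rewrite xE yE !ffunE !size_cat pm qm' => <-.
  by rewrite addKn.
move=> xm; have [|p [v [pm xE sv]]] := @upc_split m x.
  by move=> i; rewrite xm leq_addr.
have [q qm' fx] := key _ _ _ pm xE.
exists (wcat q v) => // i.
by rewrite ffunE size_cat qm' sv xm addKn subnKC.
Qed.

Lemma uniform_comp f g :
  uniform_morphism f -> uniform_morphism g -> uniform_morphism (pcomp g f).
Proof.
move=> [rf [m dm] [m' im']] ug; have [rg [r dr] [r' ir']] := ug.
have [fI fM _ [Q [iQ fQ mQ]]] := rf.
have [gI gM [R [dR fR mR]] _] := rg.
have QE : Q = uniform_product_code m'.
  by case: iQ im' => jQ eQ [jm' em']; apply: code_uniq; rewrite // -eQ.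
have RE : R = uniform_product_code r.
  by case: dR dr => jR eR [jr er]; apply: code_uniq; rewrite // -eR.
have [hI hM _ _] := nRIfin_inv rg.
have [dh ih rh] := pcomp_codes rf rg iQ fQ mQ dR fR mR.
rewrite QE RE joins_upc in dh ih; split=> //.
  exists (fun i => m i + (maxn (m' i) (r i) - m' i)).
  by rewrite -(pim_upc fI fM dm im') // => i; apply: leq_maxl.
exists (fun i => r' i + (maxn (m' i) (r i) - r i)).
rewrite -(pim_upc hI hM (m := r') (m' := r)) //.
- by rewrite /is_domC Dom_pinv.
- by rewrite /is_imC Im_pinv.
- by move=> i; apply: leq_maxr.
Qed.

(* The Brin-Higman-Thompson group nG_{k,1}: [BHT_pred] is its underlying set of
   permutations, [BHT n k] the group itself. *)
Definition BHT_pred : {pred permutation omega} :=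
  fun phi => `[< exists2 f, nRIfin f & represents f phi >].

Lemma BHT_group_closed : group_closed BHT_pred.
Proof.
split; first by apply/asboolP; exists Some; [apply: nRIfin_id|apply: represents_id].
move=> psi phi /asboolP[g rg reg] /asboolP[f rf rep]; apply/asboolP.
exists (pcomp g (pinv f)); first by apply: nRIfin_comp => //; apply: nRIfin_inv.
by apply: represents_comp => //; [apply: nRIfin_inv | apply: represents_inv].
Qed.

Record BHT := MkBHT { BHT_val :> permutation omega; _ : BHT_val \in BHT_pred }.

HB.instance Definition _ := [isSub for BHT_val].
HB.instance Definition _ := [Choice of BHT by <:].
HB.instance Definition _ :=
  SubChoice_isSubGroup.Build (permutation omega) BHT_pred BHT BHT_group_closed.

(* nG_{k,1}^unif *)
Definition BHT_unif_pred : {pred BHT} :=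
  fun phi => `[< exists2 f, uniform_morphism f & represents f phi >].

Lemma BHT_unif_group_closed : group_closed BHT_unif_pred.
Proof.
split.
  apply/asboolP; exists Some; first exact: uniform_id.
  exact: represents_id.
move=> psi phi /asboolP[g ug reg] /asboolP[f uf rep]; apply/asboolP.
have [rg _ _] := ug; have [rf _ _] := uf.
exists (pcomp g (pinv f)); first by apply: uniform_comp => //; apply: uniform_inv.
by apply: represents_comp => //; [apply: nRIfin_inv | apply: represents_inv].
Qed.

Record BHT_unif := MkBHTUnif {
  BHT_unif_val :> BHT;
  _ : BHT_unif_val \in BHT_unif_pred
}.

HB.instance Definition _ := [isSub for BHT_unif_val].
HB.instance Definition _ := [Choice of BHT_unif by <:].
HB.instance Definition _ :=
  SubChoice_isSubGroup.Build BHT BHT_unif_pred BHT_unif BHT_unif_group_closed.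

End Words.

(* Main.v *)
Require Import Defs.
From mathcomp Require Import all_boot.
From mathcomp Require Import boolp classical_sets cardinality.

(* The whole group nG_{2,1} embeds, as follows. Fix the letters a_0, a_1 of A_k.
   A coordinate x not starting with a_1 is either a_0 b with b binary, or v t
   where t starts with the first letter other than a_0, a_1, and v is empty or
   v = a_0 w with w binary. Let x lie over the binary sequence b in the first
   case, over 0^omega or w10^omega in the second case. A point is then a point
   of n2^omega together with an optional decoration t on each coordinate, where
   exactly the dyadic coordinates (ending in 0^omega) can be decorated. Elements
   of nG_{2,1} replace prefixes, so they map dyadic coordinates to dyadic
   coordinates; acting on the underlying point and keeping the decorations (and
   fixing the points with a coordinate that starts with a_1) is a faithful
   action by prefix replacements. *)

Set Implicit Arguments.
Unset Strict Implicit.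
Unset Printing Implicit Defensive.

Local Open Scope classical_set_scope.

(** * Concatenation of a finite word with a stream *)

Section StreamConcatenation.
Variable T : Type.
Implicit Types (s : seq T) (t x : nat -> T).

(* [ocat u x i] is convertible to [scat (u i) (x i)]. *)
Definition scat s t : nat -> T := fun j =>
  if j < size s then nth (t 0) s j else t (j - size s).

Lemma scat_lt (x0 : T) s t j : j < size s -> scat s t j = nth x0 s j.
Proof. by move=> lt_js; rewrite /scat lt_js; apply: set_nth_default. Qed.

Lemma scat_ge s t j : size s <= j -> scat s t j = t (j - size s).
Proof. by rewrite /scat ltnNge => ->. Qed.

Lemma scat_size s t : scat s t (size s) = t 0.
Proof. by rewrite scat_ge // subnn. Qed.

Lemma scat_cat s s' t : scat (s ++ s') t = scat s (scat s' t).
Proof.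
apply: funext => j; rewrite {1 2}/scat size_cat nth_cat.
have [lt_js|le_sj] := ltnP j (size s).
  by rewrite ltn_addr //; apply: set_nth_default.
by rewrite -{1}(subnKC le_sj) ltn_add2l subnDA.
Qed.

Lemma scat_mkseq x M : x = scat (mkseq x M) (fun j => x (M + j)).
Proof.
apply: funext => j; rewrite /scat size_mkseq.
by case: ltnP => [lt_jM|le_Mj]; rewrite ?nth_mkseq ?subnKC.
Qed.

Lemma mkseq_scat s t : mkseq (scat s t) (size s) = s.
Proof.
apply: (@eq_from_nth _ (t 0)); rewrite size_mkseq // => j lt_js.
by rewrite nth_mkseq // (scat_lt (t 0)).
Qed.

Lemma scat_compat s s' t t' : scat s t = scat s' t' ->
  s ++ drop (size s) s' = s' ++ drop (size s') s.
Proof.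
wlog le_ss' : s s' t t' / size s <= size s' => [wl|e].
  have [/wl|/ltnW/wl w e] := leqP (size s) (size s'); first exact.
  exact/esym/(w _ _ (esym e)).
rewrite (drop_oversize le_ss') cats0 -{2}(cat_take_drop (size s) s').
congr (_ ++ _); rewrite -[LHS](mkseq_scat _ t) e.
apply: (@eq_from_nth _ (t' 0)); first by rewrite size_mkseq size_takel.
move=> j; rewrite size_mkseq => lt_js.
by rewrite nth_mkseq // nth_take // (scat_lt (t' 0)) // (leq_trans lt_js).
Qed.

(** If [s] were shorter, position [size s] would carry the free letter [t 0] on one side and a fixed
    letter of [s'] on the other; two distinct letters refute this. *)
Lemma scat_inj (a b : T) s s' : a <> b ->
  (forall t, scat s t = scat s' t) -> s = s'.
Proof.
move=> nab; wlog le_ss' : s s' / size s <= size s' => [wl e|e].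
  have [/wl|/ltnW/wl w] := leqP (size s) (size s'); first exact.
  by apply/esym/w => t; rewrite e.
have ss' : size s = size s'.
  apply/eqP; rewrite eqn_leq le_ss' leqNgt; apply/negP => lt_ss'.
  have c t : t 0 = nth a s' (size s).
    by rewrite -(scat_size s t) e (scat_lt a).
  by apply: nab; rewrite (c (fun=> a)) -(c (fun=> b)).
by rewrite -(mkseq_scat s (fun=> a)) e ss' mkseq_scat.
Qed.

End StreamConcatenation.

(** * Group elements as prefix replacements at a uniform depth *)

Section UniformReplacement.
Variables n k : nat.
Implicit Types (p q : word n k) (P : set (word n k)).

Lemma ocat_inj (a b : 'I_k) (u v : word n k) : a <> b ->
  (forall x, ocat u x = ocat v x) -> u = v.
Proof.
move=> nab e; apply/ffunP => i; apply: (scat_inj nab) => t.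
exact: (congr1 (fun z => z i) (e (fun=> t))).
Qed.

Lemma ocat_compat (u v : word n k) (x y : omega n k) : ocat u x = ocat v y -> compat u v.
Proof.
move=> e; exists [ffun i => drop (size (u i)) (v i)].
exists [ffun i => drop (size (v i)) (u i)].
apply/ffunP => i; rewrite !ffunE.
exact: (scat_compat (congr1 (fun z => z i) e)).
Qed.

Lemma ocat_split (x : omega n k) M : exists p (y : omega n k),
  [/\ uniform_product_code (fun=> M) p & x = ocat p y].
Proof.
exists [ffun i => mkseq (x i) M], (fun i j => x i (M + j)); split.
  by move=> i; rewrite ffunE size_mkseq.
by apply: funext => i; rewrite [LHS](scat_mkseq _ M) /ocat ffunE.
Qed.

Lemma finite_upc M : finite_set (@uniform_product_code n k (fun=> M)).
Proof.
pose h (g : {ffun 'I_n -> M.-tuple 'I_k}) : word n k :=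
  [ffun i => tval (g i)].
apply: (@sub_finite_set _ _ (h @` setT)); last exact/finite_image/finite_finset.
move=> p pM; exists [ffun i => tcast (pM i) (in_tuple (p i))] => //.
by apply/ffunP => i; rewrite !ffunE val_tcast.
Qed.

Lemma upc_joinless m : joinless (@uniform_product_code n k m).
Proof.
apply/joinlessP => u v um vm [a [b /ffunP e]]; apply/ffunP => i.
by move: (e i); rewrite !ffunE => /eqP; rewrite eqseq_cat ?um ?vm // => /andP[/eqP].
Qed.

Lemma maximal_upc M : 0 < k ->
  maximal_joinless (@uniform_product_code n k (fun=> M)).
Proof.
move=> k0; apply/maximal_joinlessP; split; first exact: upc_joinless.
move=> w; have [p [u [pM e]]] := ocat_split (ocat w (fun _ _ => Ordinal k0)) M.
by exists p => //; apply/ocat_compat/esym/e.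
Qed.

Lemma finite_bound P : finite_set P ->
  exists M, forall p i, P p -> size (p i) <= M.
Proof.
move=> /finite_seqP[s ->]; exists (\max_(p <- s) \max_i size (p i)) => p i /= ps.
have := @leq_bigmax_seq _ s xpredT (fun p : word n k => \max_i size (p i)) p ps isT.
exact/leq_trans/(leq_bigmax (F := fun i => size (p i))).
Qed.

(* Every table refines to one whose domain code is A^M x ... x A^M. *)
Lemma BHT_predP (phi : permutation (omega n k)) : 1 < k ->
  phi \in @BHT_pred n k <->
  exists M, forall p, uniform_product_code (fun=> M) p ->
    exists q, forall x, phi (ocat p x) = ocat q x.
Proof.
move=> k1; split=> [/asboolP[f rf rep]|[M phiM]].
  have [fI fM [P [[_ dP] fP /maximal_joinlessP[_ cP]]] _] := rf.
  have [M leM] := finite_bound fP; exists M => w wM.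
  (* In each coordinate [w] is at least as long as the compatible [p], so [p] is a prefix of [w]. *)
  have [p Pp [a [b /ffunP e]]] := cP w.
  have [q fp] : Dom f p by rewrite dP; apply: mem_right_ideal.
  exists (wcat q [ffun i => drop (size (p i)) (w i)]) => u.
  apply: (representsW u rf rep).
  rewrite -(fM _ _ _ fp); congr f; apply/ffunP => i; move: (e i); rewrite !ffunE.
  by move=> /prefix_cat_drop; apply; rewrite wM leM.
have ninj : (Ordinal (ltnW k1) <> Ordinal k1) by move=> /(congr1 val).
have finj x y : (forall u, phi (ocat x u) = phi (ocat y u)) -> x = y.
  by move=> e; apply: (ocat_inj ninj) => u; apply/(can_inj (perm_funK phi))/e.
(* [f] will be the largest morphism inducing [phi] on words with all coordinates of length at least
   [M]; this bound makes [U] its domain code. *)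
pose R (x y : word n k) :=
  (forall i, M <= size (x i)) /\ forall u, phi (ocat x u) = ocat y u.
pose f : pfun n k := fun x =>
  if pselect (exists y, R x y) is left e then Some (projT1 (cid e)) else None.
have fE x y : f x = Some y <-> R x y.
  rewrite /f; case: pselect => [e|ne]; last by split=> // r; case: ne; exists y.
  case: cid => z [Mx zE] /=; split=> [[<-]//|[_ yE]]; congr Some.
  by apply: (ocat_inj ninj) => u; rewrite -zE yE.
have fI : pinjective f.
  by move=> x x' y /fE[_ e] /fE[_ e']; apply: finj => u; rewrite e e'.
have fM : right_ideal_morphism f.
  move=> x y w /fE[Mx e]; apply/fE; split=> [i|u].
    by rewrite ffunE size_cat (leq_trans (Mx i)) ?leq_addr.
  by rewrite !ocat_cat e.
pose U := @uniform_product_code n k (fun=> M).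
have fU p : U p -> exists q, f p = Some q.
  move=> pM; have [q qE] := phiM p pM.
  by exists q; apply/fE; split=> // i; rewrite pM.
have jU : joinless U by exact: upc_joinless.
have dU : Dom f = right_ideal U.
  rewrite eqEsubset; split=> [x [y /fE[Mx _]]|_ [p Up [w ->]]].
    by have [p [v [pM -> _]]] := upc_split Mx; exists p => //; exists v.
  by have [q fp] := fU p Up; exists (wcat q w); apply: fM.
pose Q : set (word n k) := [set q | exists2 p, U p & f p = Some q].
have jQ : joinless Q.
  apply/joinlessP => q q' [p Up fp] [p' Up' fp'] [a [b e]].
  apply: Some_inj; rewrite -fp -fp'; congr f.
  move/joinlessP: jU; apply=> //; exists a, b.
  by apply: (fI _ _ (wcat q a)); [apply: fM | rewrite e; apply: fM].
apply/asboolP; exists f; last by move=> P p q u _ _ /fE[_ ->].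
split=> //.
  by exists U; split=> //; [exact: finite_upc | exact/maximal_upc/ltnW].
exists Q; split.
- split=> //; rewrite eqEsubset; split=> [y [x fx]|_ [q [p _ fp] [w ->]]].
    have : Dom f x by exists y.
    rewrite dU => -[p Up [w xE]]; have [q fp] := fU p Up.
    exists q; first by exists p.
    by exists w; apply: Some_inj; rewrite -fx xE; apply: fM.
  by exists (wcat p w); apply: fM.
- apply: (@sub_finite_set _ _ ((fun p => odflt (wnil n k) (f p)) @` U)).
    by move=> q [p Up fp]; exists p => //; rewrite fp.
  exact/finite_image/finite_upc.
- apply/maximal_joinlessP; split=> // w.
  (* Maximality of [Q] comes from surjectivity of [phi]: a point with prefix [w] is pulled back and
     cut after [M] letters. *)
  pose z := ocat w (fun _ _ => Ordinal k1).
  have [p [u [Up e]]] := ocat_split (perm_inv phi z) M.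
  have [q fp] := fU p Up; exists q; first by exists p.
  move/fE: fp => [_ /(_ u) qE].
  by apply: (@ocat_compat _ _ u (fun _ _ => Ordinal k1)); rewrite -qE -e perm_invK.
Qed.

End UniformReplacement.

(** * One coordinate: base point and decoration *)

Section BinaryCoordinate.
Variable k : nat.
Local Notation letter := 'I_k.+3.
Implicit Types (x t : nat -> letter) (v : seq letter) (b : nat -> 'I_2).

Definition small : pred letter := fun a => a < 2.
Definition emb (a : 'I_2) : letter := widen_ord (isT : 2 <= k.+3) a.

Lemma embK a : inord (minn (emb a) 1) = a :> 'I_2.
Proof. by apply: val_inj; rewrite /= inordK; case: a => -[|[|]]. Qed.

Lemma emb_small a : small a -> emb (inord (minn a 1)) = a.
Proof.
by move=> a2; apply: val_inj; rewrite /= inordK; case: a a2 => -[|[|]].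
Qed.

(** The leading 0 makes room for 0^omega: the finite prefixes of the streams 0b are the empty word
    and the words 0w, matching the dyadic points 0^omega and w10^omega one to one. *)
Definition embw b := scat [:: ord0] (emb \o b).

Lemma embw_small b j : small (embw b j).
Proof. by case: j => [|j] //=; rewrite /small /embw /scat /= ltn_ord. Qed.

(* A coordinate [x] that does not start with the letter 1 reads as follows.
   If [x] is binary then [x = 0 b], and [x] lies over [b]. Otherwise [x = v t]
   where [t] starts with the first nonbinary letter, and [x] lies over the
   dyadic point 0^omega if [v] is empty, w10^omega if [v = 0 w]. *)
Definition base x : nat -> 'I_2 := fun j =>
  if all small (mkseq x j.+1) then inord (minn (x j.+1) 1) else ord0.

(* The inverse of the correspondence [v] |-> 0^omega or w10^omega (with junk
   value [::] away from the sequences that end in 0^omega). *)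
Definition dyadic_word b : seq letter :=
  if pselect (exists L, `[< forall j, L <= j -> b j = ord0 >]) is left e
  then mkseq (embw b) (ex_minn e) else [::].

(** The point over [b] with the decoration of [x]; for decorated [x] this is meaningful when [b] is
    eventually zero. *)
Definition rebase x b : nat -> letter :=
  if pselect (exists j, ~~ small (x j)) is left e
  then scat (dyadic_word b) (fun j => x (ex_minn e + j)) else embw b.

Definition ev_zero b := exists L, forall j, L <= j -> b j = ord0.

Lemma stream_cases x : (forall j, small (x j)) \/
  exists v t, [/\ x = scat v t, all small v & ~~ small (t 0)].
Proof.
have [e|ne] := pselect (exists j, ~~ small (x j)); last first.
  by left=> j; apply/negPn/negP => xj; apply: ne; exists j.
right; case: (ex_minnP e) => m xm minm.
exists (mkseq x m), (fun j => x (m + j)); split; first exact: scat_mkseq.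
  apply/(all_nthP ord0) => j; rewrite size_mkseq => lt_jm; rewrite nth_mkseq //.
  by apply: contraTT lt_jm => /minm; rewrite leqNgt.
by rewrite addn0.
Qed.

Lemma all_mkseq_small x m : all small (mkseq x m) <-> forall j, j < m -> small (x j).
Proof.
split=> [/(all_nthP ord0) h j lt_jm|h].
  by have := h j; rewrite size_mkseq nth_mkseq // => ->.
by apply/(all_nthP ord0) => j; rewrite size_mkseq => lt_jm; rewrite nth_mkseq ?h.
Qed.

Lemma rebase_small x b : (forall j, small (x j)) -> rebase x b = embw b.
Proof. by rewrite /rebase => s; case: pselect => // e; have [j /negP[]] := e. Qed.

Lemma rebase_big v t b : all small v -> ~~ small (t 0) ->
  rebase (scat v t) b = scat (dyadic_word b) t.
Proof.
move=> /(all_nthP ord0) sv bt; rewrite /rebase; case: pselect => [e|[]]; last first.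
  by exists (size v); rewrite scat_size.
case: (ex_minnP e) => m xm minm.
have -> : m = size v.
  apply/eqP; rewrite eqn_leq minm ?scat_size // leqNgt.
  by apply/negP => lt_mv; move: xm; rewrite (scat_lt ord0) // sv.
by congr scat; apply: funext => j; rewrite scat_ge ?leq_addr // addKn.
Qed.

Lemma rebase_scat v x b : all small v -> rebase (scat v x) b = rebase x b.
Proof.
move=> sv; have [sx|[v' [t [-> sv' bt]]]] := stream_cases x.
  rewrite !rebase_small // => j; rewrite /scat; case: ltnP => // lt_jv.
  by move/(all_nthP (x 0)): sv; apply.
by rewrite -scat_cat !rebase_big // all_cat sv.
Qed.

Lemma dyadic_word_all_small b : all small (dyadic_word b).
Proof.
rewrite /dyadic_word; case: pselect => // e.
by apply/all_mkseq_small => j _; apply: embw_small.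
Qed.

(** The prefix that [rebase] inserts is binary, so the decoration still starts at the first
    nonbinary letter. *)
Lemma rebase_rebase x b b' : rebase (rebase x b) b' = rebase x b'.
Proof.
have [sx|[v [t [-> sv bt]]]] := stream_cases x.
  by rewrite (rebase_small _ sx) !rebase_small // => j; apply: embw_small.
rewrite (rebase_big b) // !rebase_big //.
exact: dyadic_word_all_small.
Qed.

(** The hypotheses make [L] the least bound: 0 for 0^omega, and the length of 0w for w10^omega. *)
Lemma dyadic_wordE b L : (forall j, L <= j -> b j = ord0) ->
  (0 < L -> b L.-1 <> ord0) -> dyadic_word b = mkseq (embw b) L.
Proof.
move=> b0 bL; rewrite /dyadic_word; case: pselect => [e|[]]; last first.
  by exists L; apply/asboolP.
case: (ex_minnP e) => m /asboolP bm minm; congr mkseq; apply/eqP.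
rewrite eqn_leq minm; last exact/asboolP.
case: L {minm} b0 bL => // L b0 bL; rewrite ltnNge; apply/negP => le_mL.
by apply: bL => //; apply: bm.
Qed.

Lemma base_ge v t j : ~~ small (t 0) -> size v <= j -> base (scat v t) j = ord0.
Proof.
move=> bt le_vj; rewrite /base; case: ifP => // /all_mkseq_small /(_ (size v)).
by rewrite ltnS le_vj scat_size (negPf bt) => /(_ isT).
Qed.

(** The last case [j = size v - 1] reads [t 0]; if nonbinary, it is truncated to 1, which is the
    digit 1 of w10^omega. *)
Lemma base_lt v t j : all small v -> j < size v ->
  base (scat v t) j = inord (minn (scat v t j.+1) 1).
Proof.
move=> /(all_nthP ord0) sv lt_jv; rewrite /base; case: ifP => // /negP[].
apply/all_mkseq_small => i; rewrite ltnS => le_ij.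
have lt_iv := leq_ltn_trans le_ij lt_jv.
by rewrite (scat_lt ord0) // sv.
Qed.

Lemma dyadic_word_base v t : all small v -> head ord0 v = ord0 ->
  ~~ small (t 0) -> dyadic_word (base (scat v t)) = v.
Proof.
move=> sv v0 bt; rewrite (@dyadic_wordE _ (size v)).
- apply: (@eq_from_nth _ ord0); rewrite size_mkseq // => j lt_jv.
  rewrite nth_mkseq //; case: j lt_jv => [|j] lt_jv.
    by rewrite nth0 v0.
  rewrite /embw /scat /= subn1 /= base_lt //; last exact: ltnW.
  rewrite (scat_lt ord0) // emb_small //.
  by move/(all_nthP ord0): sv; apply.
- by move=> j; apply: base_ge.
- case: v sv {v0} => // a v sv _ /=; rewrite base_lt //.
  rewrite -[(size v).+1]/(size (a :: v)) scat_size.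
  have /minn_idPr -> : 1 <= t 0 by move: bt; rewrite /small -leqNgt => /ltnW.
  by move=> /(congr1 val); rewrite /= inordK.
Qed.

Lemma base_embw b : base (embw b) = b.
Proof.
apply: funext => j; rewrite /base; case: ifP => [_|/negP[]].
  by rewrite [embw b j.+1]/embw /scat /= subn1 embK.
by apply/all_mkseq_small => i _; apply: embw_small.
Qed.

Lemma base_dyadic_word b t : ev_zero b -> ~~ small (t 0) ->
  base (scat (dyadic_word b) t) = b.
Proof.
move=> b0 bt; have ex : exists L, `[< forall j, L <= j -> b j = ord0 >].
  by case: b0 => L; exists L; apply/asboolP.
case: (ex_minnP ex) => L /asboolP bL minL.
have bL1 : 0 < L -> b L.-1 <> ord0.
  case: L bL minL => // L bL minL _ bL0.
  suff /minL : `[< forall j, L <= j -> b j = ord0 >] by rewrite ltnn.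
  by apply/asboolP => j; rewrite leq_eqVlt => /predU1P[<-|/bL].
have sv := dyadic_word_all_small b; move: sv.
rewrite (dyadic_wordE bL bL1) => sv; apply: funext => j.
have [le_Lj|lt_jL] := leqP L j.
  by rewrite bL // base_ge // size_mkseq.
rewrite base_lt ?size_mkseq //.
have [lt_j1|] := ltnP j.+1 L.
  by rewrite (scat_lt ord0) ?size_mkseq // nth_mkseq // /embw /scat /= subn1 embK.
move=> le_Lj1; have jL : L = j.+1 by apply/eqP; rewrite eqn_leq le_Lj1.
rewrite scat_ge ?size_mkseq // jL subnn.
have /minn_idPr -> : 1 <= t 0 by move: bt; rewrite /small -leqNgt => /ltnW.
apply: val_inj; rewrite /= inordK //.
move: bL1; rewrite jL => /(_ isT) /=; case: (b j) => -[|[|]] //= ? [].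
exact: val_inj.
Qed.

Lemma base_rebase x b : ((exists j, ~~ small (x j)) -> ev_zero b) ->
  base (rebase x b) = b.
Proof.
have [sx _|[v [t [-> sv bt]]] b0] := stream_cases x.
  by rewrite rebase_small // base_embw.
rewrite rebase_big // base_dyadic_word //; apply: b0.
by exists (size v); rewrite scat_size.
Qed.

Lemma ev_zero_base x : (exists j, ~~ small (x j)) -> ev_zero (base x).
Proof.
move=> [i xi]; have [sx|[v [t [-> _ bt]]]] := stream_cases x.
  by rewrite sx in xi.
by exists (size v) => j; apply: base_ge.
Qed.

(** With 1 excluded, a binary first letter can only be 0, so the letter that [base] drops is
    recovered. *)
Lemma rebase_base x : x 0 != 1 :> nat -> rebase x (base x) = x.
Proof.
have [sx|[v [t [-> sv bt]]]] := stream_cases x => x0.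
  rewrite rebase_small //; apply: funext => -[|j].
    by apply: val_inj; move: (sx 0) x0; rewrite /small; case: (x 0) => -[|[|]].
  rewrite /embw /scat /= subn1 /base; case: ifP => [_|/negP[]].
    exact: emb_small.
  by apply/all_mkseq_small.
rewrite rebase_big // dyadic_word_base //.
case: v sv x0 => //= a v /andP[sa _]; rewrite /scat /= => a1.
by apply: val_inj; case: a sa a1 => -[|[|]].
Qed.

Lemma rebase_head x b : rebase x b 0 != 1 :> nat.
Proof.
have [sx|[v [t [-> sv bt]]]] := stream_cases x; first by rewrite rebase_small.
rewrite rebase_big //; rewrite /dyadic_word; case: pselect => [e|_].
  case: (ex_minn e) => [|L]; rewrite /scat //=.
  by move: bt; rewrite /small; case: (t 0) => -[|[|]].
by rewrite /scat /=; move: bt; rewrite /small; case: (t 0) => -[|[|]].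
Qed.

(** From position [size v - 1] on, the base depends on [t] alone, so one binary prefix can be
    exchanged for another. *)
Lemma base_tail v t j : all small v -> 0 < size v ->
  base (scat v t) ((size v).-1 + j) =
  if all small (mkseq t j) then inord (minn (t j) 1) else ord0.
Proof.
move=> sv v0; rewrite /base -addSn prednK //.
rewrite scat_ge ?leq_addr // addKn; congr (if _ then _ else _).
apply/idP/idP => /all_mkseq_small h; apply/all_mkseq_small => i lt_i.
  by have := h (size v + i); rewrite ltn_add2l scat_ge ?leq_addr // addKn => ->.
have [lt_iv|le_vi] := ltnP i (size v).
  by rewrite (scat_lt ord0) //; move/(all_nthP ord0): sv; apply.
by rewrite scat_ge // h // ltn_subLR.
Qed.

(** Replacing the first [M] base digits by [z] is a prefix replacement upstairs: [p] becomes 0z if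
    it is binary, and otherwise only its part before the decoration changes. *)
Lemma rebase_replace M (p : seq letter) (z : seq 'I_2) :
  size p = M.+1 -> head ord0 p != 1 :> nat ->
  exists q, forall t, rebase (scat p t)
    (scat z (fun j => base (scat p t) (M + j))) = scat q t.
Proof.
move=> pM p0; have [sp|nsp] := boolP (all small p).
  exists (ord0 :: map emb z) => t; set q := ord0 :: _.
  have sq : all small q.
    by rewrite /q /=; apply/allP => _ /mapP[a _ ->]; apply: (ltn_ord a).
  rewrite -(rebase_base (x := scat q t)) // !rebase_scat //; congr rebase.
  apply: funext => j; have [lt_jz|le_zj] := ltnP j (size z).
    rewrite (scat_lt ord0) // base_lt //; last by rewrite /= size_map ltnW.
    by rewrite (scat_lt ord0) /= ?size_map // (nth_map ord0) // embK.
  rewrite scat_ge // -[in RHS](subnKC le_zj).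
  have -> : M = (size p).-1 by rewrite pM.
  have {2}-> : size z = (size q).-1 by rewrite /= size_map.
  by rewrite !base_tail // pM.
have hp : has (predC small) p by rewrite has_predC.
set i := find (predC small) p; have lt_ip : i < size p by rewrite -has_find.
have sv : all small (take i p).
  apply/(all_nthP ord0) => j; rewrite size_takel ?(ltnW lt_ip) // => lt_ji.
  by have := before_find ord0 lt_ji; rewrite nth_take //= => /negbFE.
(* The decoration starts inside [p], so the base digits from [M] on vanish and the new base is
   z0^omega for every [t]. *)
exists (dyadic_word (scat z (fun=> ord0)) ++ drop i p) => t.
have pE : scat p t = scat (take i p) (scat (drop i p) t).
  by rewrite -scat_cat cat_take_drop.
have bt : ~~ small (scat (drop i p) t 0).
  rewrite (scat_lt ord0) ?size_drop ?subn_gt0 // nth_drop addn0.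
  exact: (nth_find ord0 hp).
rewrite {1}pE rebase_big // scat_cat; congr (scat (dyadic_word (scat _ _)) _).
apply: funext => j; rewrite pE base_ge // size_takel ?(ltnW lt_ip) //.
by apply: leq_trans (leq_addr _ _); rewrite -ltnS -pM.
Qed.

End BinaryCoordinate.

(** * The action of nG_{2,1} on decorated points *)

Section Lift.
Variables n k : nat.
Implicit Types (g h : BHT n 2) (x : omega n k.+3).

Definition obase x : omega n 2 := fun i => base (x i).

Definition in_domain x := [forall i, x i 0 != 1 :> nat].

(** One test governs all coordinates, because each coordinate of [g (obase x)] may depend on every
    coordinate of [x]. *)
Definition lift_fun g x : omega n k.+3 := fun i =>
  if in_domain x then rebase (x i) (g (obase x) i) else x i.

Lemma BHT_replace g : exists M, forall p, uniform_product_code (fun=> M) p ->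
  exists q, forall u, g (ocat p u) = ocat q u.
Proof. by apply/BHT_predP => //; apply: (valP g). Qed.

(** Prefix replacement keeps the tail of each coordinate and only shifts where its zeros begin. *)
Lemma BHT_ev_zero g (y : omega n 2) i : ev_zero (y i) -> ev_zero (g y i).
Proof.
have [M gM] := BHT_replace g; have [p [u [pM ->]]] := ocat_split y M.
have [q ->] := gM p pM => -[L yL]; exists (size (q i) + L) => j le_j.
have le_qj : size (q i) <= j by apply: leq_trans le_j; apply: leq_addr.
rewrite [LHS]scat_ge // -(yL (size (p i) + (j - size (q i)))).
  by rewrite [RHS]scat_ge ?leq_addr // addKn.
by apply: leq_trans (leq_addl _ _); rewrite leq_subRL.
Qed.

Lemma obase_lift g x : in_domain x -> obase (lift_fun g x) = g (obase x).
Proof.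
move=> dx; apply: funext => i; rewrite /obase /lift_fun dx base_rebase //.
by move=> /ev_zero_base; apply: BHT_ev_zero.
Qed.

Lemma lift_fun_id g x : ~~ in_domain x -> lift_fun g x = x.
Proof. by move=> /negPf ndx; rewrite /lift_fun ndx. Qed.

Lemma in_domain_lift g x : in_domain (lift_fun g x) = in_domain x.
Proof.
have [dx|ndx] := boolP (in_domain x); last by rewrite lift_fun_id // (negPf ndx).
by apply/forallP => i; rewrite /lift_fun dx; apply: rebase_head.
Qed.

(** The lift of [h] moves the base by [h] and keeps the decorations, so the lift of [g] then applies
    [g] to the moved base. *)
Lemma lift_funM g h x : lift_fun (g * h)%g x = lift_fun g (lift_fun h x).
Proof.
have [dx|ndx] := boolP (in_domain x); last by rewrite !lift_fun_id.
apply: funext => i; rewrite [RHS]/lift_fun in_domain_lift obase_lift // dx.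
by rewrite /lift_fun dx rebase_rebase.
Qed.

Lemma lift_fun1 x : lift_fun 1%g x = x.
Proof.
apply: funext => i; rewrite /lift_fun.
by case: ifP => // /forallP dx; apply: rebase_base.
Qed.

Lemma lift_funK g : cancel (lift_fun g) (lift_fun g^-1%g).
Proof. by move=> x; rewrite -lift_funM mulVg lift_fun1. Qed.

Lemma lift_funVK g : cancel (lift_fun g^-1%g) (lift_fun g).
Proof. by move=> x; rewrite -lift_funM mulgV lift_fun1. Qed.

Definition lift_perm g := Permutation (lift_funK g) (lift_funVK g).

Lemma lift_perm_BHT g : lift_perm g \in @BHT_pred n k.+3.
Proof.
(* The extra letter is the leading one, which [base] drops. *)
have [M gM] := BHT_replace g; apply/BHT_predP => //; exists M.+1 => p pM.
have [/forallP dp|/forallPn[i /negPn pi1]] :=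
  boolP [forall i, nth ord0 (p i) 0 != 1 :> nat]; last first.
  exists p => u; apply: funext => i'; rewrite /= /lift_fun.
  case: ifP => // /forallP/(_ i).
  by rewrite /ocat pM /= (set_nth_default ord0) ?pM // pi1.
have dpu u : in_domain (ocat p u).
  apply/forallP => i.
  by rewrite /ocat pM /= (set_nth_default ord0) ?pM // dp.
(* The [M.+1] letters of [p i] determine [M] base digits, so the padding by 0 is arbitrary. *)
pose w : word n 2 := [ffun i => mkseq (base (scat (p i) (fun=> ord0))) M].
have wM : uniform_product_code (fun=> M) w.
  by move=> i; rewrite ffunE size_mkseq.
have [z gz] := gM w wM.
have baseE u : obase (ocat p u) =
    ocat w (fun i j => base (scat (p i) (u i)) (M + j)).
  apply: funext => i; apply: etrans (scat_mkseq (base _) M) _.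
  rewrite -[RHS]/(scat (w i) _) ffunE -[ocat p u i]/(scat (p i) (u i)).
  congr scat.
  apply: (@eq_from_nth _ ord0); rewrite !size_mkseq // => j lt_jM.
  rewrite !nth_mkseq // /base.
  have eqx m : m < M.+1 -> scat (p i) (u i) m = scat (p i) (fun=> ord0) m.
    by move=> lt_mM; rewrite !(scat_lt ord0) ?pM.
  rewrite eqx //; congr (if _ then _ else _); congr all.
  apply/eq_in_map => m; rewrite mem_iota => /andP[_ lt_mj].
  by apply/eqx/(leq_trans lt_mj)/ltnW.
suff /choice[q qE] : forall i, exists q, forall u : nat -> 'I_k.+3,
    rebase (scat (p i) u) (scat (z i) (fun j => base (scat (p i) u) (M + j)))
    = scat q u.
  exists [ffun i => q i] => u; apply: funext => i.
  by rewrite /= /lift_fun dpu baseE gz /ocat ffunE; apply: qE.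
move=> i; apply: rebase_replace; first exact: pM.
by rewrite -nth0; apply: dp.
Qed.

Definition lift g : BHT n k.+3 := MkBHT (lift_perm_BHT g).

Lemma liftM : {morph lift : g h / (g * h)%g}.
Proof.
move=> g h; apply/val_inj/permutation_ext => x; exact: lift_funM.
Qed.

(** The undecorated points [embw k (y i)] form a copy of n2^omega on which [g] can be read off. *)
Lemma lift_inj : injective lift.
Proof.
move=> g h e; apply/val_inj/permutation_ext => y.
pose x : omega n k.+3 := fun i => embw k (y i).
have dx : in_domain x by apply/forallP.
have xy : obase x = y by apply: funext => i; apply: base_embw.
by rewrite -xy -!obase_lift // -[lift_fun g]/(lift g : _ -> _) e.
Qed.

End Lift.

(** * Restriction of the embedding to the uniform subgroup *)

Theorem lemma5p24 (k n : nat) (hk : 3 <= k) (hn : 2 <= n) :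
  exists iota : BHT_unif n 2 -> BHT n k,
    {morph iota : x y / (x * y)%g} /\ injective iota.
Proof.
case: k hk => [|[|[|k]]] // _.
exists (fun g => lift k (BHT_unif_val g)); split=> [g h|g h /lift_inj/val_inj //].
exact: liftM.
Qed.
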